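(* Let $X$ be a real Hilbert space and let $A:X\to 2^X$ be a monotone linear relation such that $\operatorname{dom}A$ is dense in $(A0)^\perp$ and $A0$ is closed. If $A$ is $3^*$-monotone, then $A$ is also paramonotone.
   Context: For a set-valued operator $T:X\to 2^X$: $\operatorname{dom}T=\{x:Tx\neq\emptyset\}$, $\operatorname{gra}T=\{(x,x^* ):x^*\in Tx\}$, and the range of $T$ is $\bigcup_xTx$. $T$ is monotone if $\langle x-y,x^*-y^*\rangle\ge0$ for all $(x,x^* ),(y,y^* )\in\operatorname{gra}T$. - $T$ is paramonotone if it is monotone and, for all $(x,x^* ),(y,y^* )\in\operatorname{gra}T$, $\langle x-y,x^*-y^*\rangle=0$ implies $x^*\in Ty$ and $y^*\in Tx$. - $T$ is $3^*$-monotone if it is monotone and, for all $z$ in the domain of $T$ and all $x^*$ in the range of $T$, $\sup_{(y,y^* )\in\operatorname{gra}T}\langle z-y,y^*-x^*\rangle<+\infty$. $A:X\to 2^X$ is a linear relation if $\operatorname{dom}A$ is a linear subspace of $X$ and, for all $x,y\in\operatorname{dom}A$ and $\lambda\in\mathbb{R}$, $\lambda Ax\subset A(\lambda x)$ and $Ax+Ay\subset A(x+y)$. $A0$ denotes $A(0)$, and $C^\perp=\{x\in X:\langle x,c\rangle=0\ \forall c\in C\}$. *)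

(* Defs.v *)
From mathcomp Require Import all_boot all_order all_algebra.
From mathcomp Require Import all_classical all_reals all_analysis.

Set Implicit Arguments.
Unset Strict Implicit.
Unset Printing Implicit Defensive.

Import Order.TTheory GRing.Theory Num.Theory.
Import numFieldNormedType.Exports.

Local Open Scope classical_set_scope.
Local Open Scope ring_scope.

(* A set-valued operator T : X -> 2^X is a function T : X -> set X. *)

Definition dom (X : Type) (T : X -> set X) : set X := [set x | T x !=set0].

Definition gra (X : Type) (T : X -> set X) : set (X * X) :=
  [set p | T p.1 p.2].

Definition ran (X : Type) (T : X -> set X) : set X := \bigcup_x T x.

Definition dense_in (X : topologicalType) (S C : set X) : Prop :=
  S `<=` C /\ C `<=` closure S.

Definition linear_relation (R : realType) (X : lmodType R) (A : X -> set X) :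
    Prop :=
  [/\ submod_closed (mem (dom A)),
      forall (l : R) x, dom A x -> [set l *: u | u in A x] `<=` A (l *: x)
    & forall x y, dom A x -> dom A y ->
        [set u + v | u in A x & v in A y] `<=` A (x + y)].

(* `{dot X for idfun}` is the type of symmetric positive definite bilinear
   forms on X. The norm is a separate field of the normed module X, so it has
   to be tied to the form; completeness is part of completeNormedModType. *)
Definition hilbert_inner (R : realType) (X : completeNormedModType R)
    (ip : {dot X for idfun}) : Prop :=
  forall x : X, `|x| ^+ 2 = ip x x.

Section operators.
Variables (R : realType) (X : lmodType R) (ip : {dot X for idfun}).
Implicit Type T : X -> set X.

Definition perp (C : set X) : set X := [set x | forall c, C c -> ip x c = 0].

Definition monotone_op T : Prop :=
  forall x xs y ys, gra T (x, xs) -> gra T (y, ys) -> 0 <= ip (x - y) (xs - ys).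

Definition paramonotone_op T : Prop :=
  monotone_op T /\
  forall x xs y ys, gra T (x, xs) -> gra T (y, ys) ->
    ip (x - y) (xs - ys) = 0 -> T y xs /\ T x ys.

Definition three_star_monotone_op T : Prop :=
  monotone_op T /\
  forall z xs, dom T z -> ran T xs ->
    (ereal_sup [set (ip (z - p.1) (p.2 - xs))%:E | p in gra T] < +oo)%E.

End operators.

(* Main.v *)
Require Import Defs.
From mathcomp Require Import all_boot all_order all_algebra.
From mathcomp Require Import all_classical all_reals all_analysis.
From mathcomp Require Import ring lra.
Import Order.TTheory GRing.Theory Num.Theory.
Import numFieldNormedType.Exports.

Set Implicit Arguments.
Unset Strict Implicit.
Unset Printing Implicit Defensive.

(** Put z = x - y and zs = xs - ys, where xs and ys are values of A at x and y
    with <z, zs> = 0. By linearity zs is a value of A at z, and xs, ys can be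
    exchanged between the fibres A x and A y as soon as zs lies in A 0, because
    every fibre of a linear relation is a translate of A 0.

    To see that zs lies in A 0, test the 3*-condition at a point w of the domain
    and the value 0 of the range along the line of graph points (t z, t zs).
    Since <z, zs> = 0, the quantity <w - t z, t zs> is just t <w, zs>; it is
    bounded above in t, so <w, zs> = 0 (three_star_null_perp). Hence zs is
    orthogonal to dom A, and by density and continuity of the inner product to
    the whole of the orthogonal complement of A 0 (perp_dense). A closed
    subspace of a Hilbert space is its own double orthogonal complement
    (perp_perp_closed), so zs lies in A 0.

    The last fact comes from the existence of a nearest point in a closed
    subspace (exists_nearest_point). *)

Local Open Scope classical_set_scope.
Local Open Scope ring_scope.

Lemma linear_bounded_eq0 (R : realFieldType) (b C : R) :
  (forall t, t * b <= C) -> b = 0.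
Proof.
move=> bC; apply/eqP; case: eqVneq => // b0.
have := bC ((C + 1) / b); rewrite divfK //; lra.
Qed.

(** A linear function dominated by a quadratic one without linear term must
    vanish: the first order wins near 0. *)
Lemma linear_le_square_eq0 (R : realFieldType) (b c : R) :
  0 <= c -> (forall t, 2 * t * b <= t ^+ 2 * c) -> b = 0.
Proof.
move=> c0 bc; apply/eqP; rewrite -sqrf_eq0.
have c1 : 0 < c + 1 by lra.
(* The maximum of 2 t b - t^2 c is at t = b / c; adding 1 to the denominator
   covers c = 0. *)
set s := b / (c + 1).
have bE : b = s * (c + 1) by rewrite divfK // gt_eqF.
have := bc s; rewrite {1}bE => H.
have s0 : s ^+ 2 = 0.
  by apply/eqP; rewrite eq_le sqr_ge0 andbT; nra.
by rewrite bE exprMn s0 mul0r.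
Qed.

Lemma submod_closed_setP (R : realType) (X : lmodType R) (M : set X) :
  submod_closed (mem M) <->
  M 0 /\ forall (t : R) x y, M x -> M y -> M (t *: x + y).
Proof.
split=> [[M0 MD]|[M0 MD]].
  split=> [|t x y Mx My]; first exact: set_mem M0.
  by apply: set_mem; apply: MD; apply: mem_set.
split; first exact: mem_set.
by move=> t x y /set_mem Mx /set_mem My; apply: mem_set; apply: MD.
Qed.

Section inner_product.
Variables (R : realType) (X : normedModType R) (ip : {dot X for idfun}).
Hypothesis ip_norm : forall x : X, `|x| ^+ 2 = ip x x.

Lemma ipC x y : ip x y = ip y x.
Proof. by rewrite (hermC ip) /= expr0 mul1r. Qed.

Lemma normD_sqr x y : `|x + y| ^+ 2 = `|x| ^+ 2 + 2 * ip x y + `|y| ^+ 2.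
Proof. by rewrite !ip_norm linearDl !linearDr /= (ipC y x); ring. Qed.

Lemma normB_sqr x y : `|x - y| ^+ 2 = `|x| ^+ 2 - 2 * ip x y + `|y| ^+ 2.
Proof. by rewrite normD_sqr linearNr normrN /=; ring. Qed.

Lemma ip_polarization x y : ip x y = (`|x + y| ^+ 2 - `|x - y| ^+ 2) / 4.
Proof. by rewrite normD_sqr normB_sqr; field. Qed.

(** By polarization the inner product inherits the continuity of the norm. *)
Lemma ip_continuousl y : continuous (ip^~ y).
Proof.
have -> : ip^~ y = fun x => (`|x + y| ^+ 2 - `|x - y| ^+ 2) / 4.
  by apply/funext => x; exact: ip_polarization.
move=> x; apply: cvgMl; apply: cvgB; rewrite expr2; apply: cvgM;
  apply: cvg_norm; (apply: cvgD || apply: cvgB); by [exact: cvg_id | exact: cvg_cst].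
Qed.

Lemma perp_dense (S C : set X) y :
  C `<=` closure S -> (forall x, S x -> ip x y = 0) -> perp ip C y.
Proof.
move=> CS Sy c /CS Sc; rewrite ipC.
have cl : closed [set x | ip x y = 0].
  apply: (@closed_comp _ _ (ip^~ y) [set 0]); last exact: closed_eq.
  by move=> x _; exact: ip_continuousl.
by move: Sc => /(closure_subset (B := [set x | ip x y = 0]) Sy)/cl.
Qed.

(** The first-order condition for the minimum of the distance to u: moving m by
    t c inside M changes the squared distance by - 2 t <u - m, c> + t^2 |c|^2. *)
Lemma nearest_point_perp (M : set X) u m :
  submod_closed (mem M) -> M m -> (forall c, M c -> `|u - m| <= `|u - c|) ->
  perp ip M (u - m).
Proof.
move=> /submod_closed_setP[M0 MD] Mm min c Mc.
apply: (@linear_le_square_eq0 _ _ (`|c| ^+ 2)); first exact: sqr_ge0.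
move=> t; have := min _ (MD t c m Mc Mm).
rewrite -(ler_pXn2r (n := 2)) ?nnegrE ?normr_ge0 //.
have -> : u - (t *: c + m) = (u - m) - t *: c by rewrite opprD addrA addrAC.
rewrite [X in _ <= X]normB_sqr linearZr_LR /= normrZ exprMn real_normK ?num_real //.
lra.
Qed.

(** The parallelogram identity applied to u - a and u - b: it bounds the distance
    of two almost nearest points of a convex set, which contains their midpoint. *)
Lemma midpoint_norm_sqr (u a b : X) :
  `|a - b| ^+ 2 = 2 * `|u - a| ^+ 2 + 2 * `|u - b| ^+ 2
    - 4 * `|u - (2^-1 : R) *: (a + b)| ^+ 2.
Proof.
have ipM : ip u ((2^-1 : R) *: (a + b)) = 2^-1 * (ip u a + ip u b).
  by rewrite linearZr_LR linearDr.
rewrite !normB_sqr ipM normrZ exprMn normD_sqr.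
by rewrite ger0_norm ?invr_ge0 //; field.
Qed.

End inner_product.

Section projection.
Variables (R : realType) (X : completeNormedModType R) (ip : {dot X for idfun}).
Hypothesis ip_norm : forall x : X, `|x| ^+ 2 = ip x x.

(** A minimizing sequence for the distance to u is Cauchy by the midpoint
    identity, and its limit stays in M because M is closed. *)
Lemma exists_nearest_point (M : set X) u : submod_closed (mem M) -> closed M ->
  exists2 m, M m & forall c, M c -> `|u - m| <= `|u - c|.
Proof.
move=> /submod_closed_setP[M0 MD] Mcl.
pose E : set R := [set `|u - c| ^+ 2 | c in M]; pose d : R := inf E.
have E0 : has_inf E.
  by split; [exists (`|u - 0| ^+ 2); exists 0 | exists 0 => _ [c _ <-]; exact: sqr_ge0].
have dE c : M c -> d <= `|u - c| ^+ 2.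
  by move=> Mc; apply: ge_inf; [exact: E0.2 | exists c].
have /choice[m mP] : forall n : nat, exists c, M c /\ `|u - c| ^+ 2 < d + n.+1%:R^-1.
  move=> n; have [|_ [c Mc <-] H] := @inf_adherent _ E n.+1%:R^-1 _ E0.
    by rewrite invr_gt0.
  by exists c.
have near_inf (e : R) : 0 < e -> \forall n \near \oo, (n.+1%:R^-1 : R) < e.
  by move=> e0; near=> n; near: n; exact: near_infty_natSinv_lt (PosNum e0).
have m_cvg : cvg (m @ \oo).
  apply/cauchy_cvgP/cauchyP => e e0.
  (* The midpoint identity gives |m N - m n|^2 <= 2 / (N + 1) + 2 / (n + 1),
     hence the tolerance e^2 / 4 on both reciprocals. *)
  have e4 : 0 < e ^+ 2 / 4 by rewrite divr_gt0 // exprn_gt0.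
  have [N _ NP] := near_inf _ e4.
  exists (m N).
  change (\forall n \near \oo, ball (m N) e (m n)); near=> n.
  have Nn : (N <= n)%N by near: n; exact: nbhs_infty_ge.
  rewrite /= -ball_normE /=.
  rewrite -(ltr_pXn2r (n := 2)) ?nnegrE ?normr_ge0 ?ltW //.
  rewrite (midpoint_norm_sqr ip_norm u).
  (* The midpoint 2^-1 *: (1 *: m N + m n) + 0 is in M. *)
  have := dE _ (MD 2^-1 _ _ (MD 1 _ _ (mP N).1 (mP n).1) M0).
  rewrite scale1r addr0.
  move: (NP N (leqnn N)) (NP n Nn) (mP N).2 (mP n).2 => /=.
  move: (N.+1%:R^-1) (n.+1%:R^-1) => p q; lra.
exists (lim (m @ \oo)).
  by apply: (closed_cvg _ Mcl _ _ m_cvg); apply: nearW => n; exact: (mP n).1.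
move=> c Mc; rewrite -(ler_pXn2r (n := 2)) ?nnegrE ?normr_ge0 //.
apply: le_trans (dE _ Mc); apply/ler_addgt0Pr => e e0.
have dist_cvg : `|u - m n| ^+ 2 @[n --> \oo] --> `|u - lim (m @ \oo)| ^+ 2.
  rewrite expr2; apply: cvgM; apply: cvg_norm; apply: cvgB => //; exact: cvg_cst.
have := @closed_cvg _ _ _ _ _ _ (@closed_le _ (d + e)) _ _ dist_cvg; apply.
near=> n; apply: ltW (lt_le_trans (mP n).2 _); rewrite lerD2l ltW //.
by near: n; exact: near_inf.
Unshelve. all: by end_near.
Qed.

(** If m is the point of M nearest to u, then u - m is orthogonal to M, hence to
    both m and u, hence to itself. *)
Lemma perp_perp_closed (M : set X) : submod_closed (mem M) -> closed M ->
  perp ip (perp ip M) `<=` M.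
Proof.
move=> Msub Mcl u uMM.
have [m Mm min] := exists_nearest_point u Msub Mcl.
have umM := nearest_point_perp ip_norm Msub Mm min.
suff : `|u - m| ^+ 2 = 0.
  by move/eqP; rewrite sqrf_eq0 normr_eq0 subr_eq0 => /eqP ->.
have um0 : ip u (u - m) = 0 by exact: uMM.
have mu0 : ip m (u - m) = 0 by rewrite ipC umM.
by rewrite ip_norm linearBl /= um0 mu0 subr0.
Qed.

End projection.

Section linear_relations.
Variables (R : realType) (X : lmodType R) (A : X -> set X).
Hypothesis A_linear : linear_relation A.

Lemma linear_relationD x xs y ys : A x xs -> A y ys -> A (x + y) (xs + ys).
Proof.
have [_ _ AD] := A_linear => Ax Ay.
by apply: (AD x y); [exists xs | exists ys | exists xs => //; exists ys].
Qed.

Lemma linear_relationZ (t : R) x xs : A x xs -> A (t *: x) (t *: xs).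
Proof.
have [_ AZ _] := A_linear => Ax.
by apply: (AZ t x); [exists xs | exists xs].
Qed.

Lemma linear_relationB x xs y ys : A x xs -> A y ys -> A (x - y) (xs - ys).
Proof.
move=> Ax Ay; rewrite -[- y]scaleN1r -[- ys]scaleN1r.
by apply: linear_relationD => //; exact: linear_relationZ.
Qed.

Lemma linear_relation00 : A 0 0.
Proof.
have [/submod_closed_setP[[xs A0] _] _ _] := A_linear.
by have := linear_relationB A0 A0; rewrite !subrr.
Qed.

Lemma linear_relation0_submod : submod_closed (mem (A 0)).
Proof.
apply/submod_closed_setP; split=> [|t x y A0x A0y]; first exact: linear_relation00.
by have := linear_relationD (linear_relationZ t A0x) A0y; rewrite scaler0 addr0.
Qed.

End linear_relations.

(** Along the graph points (t z, t zs) the quadratic term of the expression in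
    the 3*-condition vanishes, and a linear function of t bounded above is 0. *)
Lemma three_star_null_perp (R : realType) (X : lmodType R)
    (ip : {dot X for idfun}) (A : X -> set X) z zs :
  linear_relation A -> three_star_monotone_op ip A ->
  A z zs -> ip z zs = 0 -> forall w, dom A w -> ip w zs = 0.
Proof.
move=> Alin [_ A3] Az zzs w Aw.
have ran0 : ran A 0 by exists 0 => //; exact: linear_relation00.
have := A3 w 0 Aw ran0; set S := [set _ | _ in _] => supS.
have [C SC] : exists C : R, (ereal_sup S <= C%:E)%E.
  case: (ereal_sup S) supS => [r| |] // _; first by exists r.
  by exists 0; rewrite leNye.
apply: (@linear_bounded_eq0 _ _ C) => t.
rewrite -lee_fin; apply: le_trans SC; apply: ereal_sup_ubound.
exists (t *: z, t *: zs); first exact: linear_relationZ.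
by rewrite /= subr0 linearZr_LR linearBl linearZl_LR /= zzs mulr0 subr0.
Qed.

Theorem proposition5p4 (R : realType) (X : completeNormedModType R)
    (ip : {dot X for idfun}) (ip_norm : hilbert_inner ip)
    (A : X -> set X)
    (A_linear : linear_relation A)
    (A_monotone : monotone_op ip A)
    (A_dense : dense_in (dom A) (perp ip (A 0)))
    (A0_closed : closed (A 0)) :
  three_star_monotone_op ip A -> paramonotone_op ip A.
Proof.
move=> A3; split=> // x xs y ys /= Ax Ay xy0.
have A0z : A 0 (xs - ys).
  apply: (perp_perp_closed ip_norm (linear_relation0_submod A_linear)) => //.
  apply: (perp_dense ip_norm A_dense.2).
  by apply: (three_star_null_perp A_linear A3) xy0; exact: linear_relationB.
split.
  by rewrite -(subrK ys xs) -(add0r y); exact: linear_relationD.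
by rewrite -(subKr xs ys) -(subr0 x); exact: linear_relationB.
Qed.
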